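(* $\mathbb{SAOL}=V_{\mathbb{BZL}}(\mathbf{D}_2\oplus\mathrm{Si}(\mathbb{SAOL})_{BI}\oplus\mathbf{D}_2)=V_{\mathbb{BZL}}(\mathbf{D}_2\oplus\mathbb{SAOL}_{BI}\oplus\mathbf{D}_2)=V_{\mathbb{BZL}}(\mathbf{D}_2\oplus\mathbb{PKA}\oplus\mathbf{D}_2)$.
   Context: A BI-lattice is an algebra $(L,\wedge,\vee,\cdot',0,1)$ such that $(L,\wedge,\vee,0,1)$ is a bounded lattice and $\cdot'$ is order-reversing with $a''=a$. A pseudo-Kleene algebra is a BI-lattice with $a\wedge a'\le b\vee b'$ for all $a,b$; $\mathbb{PKA}$ is the variety of pseudo-Kleene algebras. A BZ-lattice is an algebra $(L,\wedge,\vee,\cdot',\cdot^{\sim},0,1)$ such that $(L,\wedge,\vee,\cdot',0,1)$ is a pseudo-Kleene algebra and $\cdot^{\sim}$ is order-reversing with $a\wedge a^{\sim}=0$ and $a\le a^{\sim\sim}=a^{\sim\prime}$ for all $a$; $\mathbb{BZL}$ is the variety of BZ-lattices. A PBZ$^*$-lattice is a BZ-lattice satisfying $(x\wedge x')^{\sim}\approx x^{\sim}\vee x'^{\sim}$ that is paraorthomodular (if $a\le b$ and $a'\wedge b=0$, then $a=b$); PBZ$^*$-lattices form a variety. An antiortholattice is a PBZ$^*$-lattice in which $\{x:x\vee x'=1\}=\{0,1\}$, equivalently a PBZ$^*$-lattice whose Brouwer complement is trivial, i.e. $0^{\sim}=1$ and $a^{\sim}=0$ for all $a\ne 0$; $\mathbb{AOL}$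 is the class of antiortholattices. Trivial (one-element) algebras are allowed. $V_{\mathbb{BZL}}(\mathbb{C})$ denotes the variety of BZ-lattices generated by $\mathbb{C}$. $\mathbb{SDM}$ is the variety of PBZ$^*$-lattices satisfying $(x\wedge y)^{\sim}\approx x^{\sim}\vee y^{\sim}$, and $\mathbb{SAOL}=\mathbb{SDM}\cap V_{\mathbb{BZL}}(\mathbb{AOL})$. $\mathrm{Si}(\mathbb{SAOL})$ is the class of subdirectly irreducible members of $\mathbb{SAOL}$ (the trivial algebra is considered subdirectly irreducible). For a class $\mathbb{D}$ of BZ-lattices, $\mathbb{D}_{BI}$ is the class of the BI-lattice reducts $(L,\wedge,\vee,\cdot',0,1)$ of the members of $\mathbb{D}$. For a pseudo-Kleene algebra $\mathbf{K}$, $\mathbf{D}_2\oplus\mathbf{K}\oplus\mathbf{D}_2$ is obtained from $\mathbf{K}$ by adding a new bottom element $0$ and a new top element $1$, extending the involution of $\mathbf{K}$ by $0'=1$, $1'=0$, and endowing the result with the trivial Brouwer complement; it is an antiortholattice. For a class $\mathbb{C}$ of pseudo-Kleene algebras, $\mathbf{D}_2\oplus\mathbb{C}\oplus\mathbf{D}_2=\{\mathbf{D}_2\oplus\mathbf{K}\oplus\mathbf{D}_2:\mathbf{K}\in\mathbb{C}\}$. *)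

(* Defs.v *)
From HB Require Import structures.
From mathcomp Require Import all_boot all_order.
From mathcomp Require Import boolp.
Set Implicit Arguments.
Unset Strict Implicit.
Unset Printing Implicit Defensive.
Import Order.Theory.
Local Open Scope order_scope.

HB.mixin Record TBLattice_isBILattice (d : Order.disp_t) L
    of Order.TBLattice d L := {
  kneg : L -> L;
  kneg_anti : forall x y : L, x <= y -> kneg y <= kneg x;
  knegK : involutive kneg
}.

#[short(type="biLatticeType")]
HB.structure Definition BILattice (d : Order.disp_t) :=
  { L of TBLattice_isBILattice d L & Order.TBLattice d L }.

HB.mixin Record BILattice_isPKA (d : Order.disp_t) L of BILattice d L := {
  kleene : forall x y : L, x `&` kneg x <= y `|` kneg y
}.

#[short(type="pkaType")]
HB.structure Definition PKA (d : Order.disp_t) :=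
  { L of BILattice_isPKA d L & BILattice d L }.

HB.mixin Record PKA_isBZLattice (d : Order.disp_t) L of PKA d L := {
  bneg : L -> L;
  bneg_anti : forall x y : L, x <= y -> bneg y <= bneg x;
  meet_bneg : forall x : L, x `&` bneg x = \bot;
  le_bnegK : forall x : L, x <= bneg (bneg x);
  bneg_bneg : forall x : L, bneg (bneg x) = kneg (bneg x)
}.

#[short(type="bzLatticeType")]
HB.structure Definition BZLattice (d : Order.disp_t) :=
  { L of PKA_isBZLattice d L & PKA d L }.

(* A class of algebras is a predicate on bundled structures of a fixed        *)
(* display, which is a phantom parameter.                                     *)
Notation bz_class d := (bzLatticeType d -> Prop).
Notation pka_class d := (pkaType d -> Prop).

Definition same_class (T : Type) (C D : T -> Prop) : Prop :=
  forall A, C A <-> D A.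
Notation "C =c D" := (same_class C D) (at level 70, no associativity).

Record bz_hom (d : Order.disp_t) (A B : bzLatticeType d) (f : A -> B) : Prop :=
  BZHom {
    bz_homI : {morph f : x y / x `&` y};
    bz_homU : {morph f : x y / x `|` y};
    bz_homK : {morph f : x / kneg x};
    bz_homB : {morph f : x / bneg x};
    bz_hom0 : f \bot = \bot;
    bz_hom1 : f \top = \top
  }.

Definition surjective (A B : Type) (f : A -> B) : Prop :=
  forall y, exists x, f x = y.

Definition dprod (d : Order.disp_t) (I : Type) (A : I -> bzLatticeType d) :=
  forall i, A i.

Section DirectProduct.
Variables (d : Order.disp_t) (I : Type) (A : I -> bzLatticeType d).
Implicit Types f g h : dprod A.

HB.instance Definition _ := Choice.copy (dprod A) (forall i, A i : choiceType).

Definition dprod_le f g : bool := `[< forall i, f i <= g i >].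
Definition dprod_meet f g : dprod A := fun i => f i `&` g i.
Definition dprod_join f g : dprod A := fun i => f i `|` g i.
Definition dprod_bot : dprod A := fun i => \bot.
Definition dprod_top : dprod A := fun i => \top.
Definition dprod_kneg f : dprod A := fun i => kneg (f i).
Definition dprod_bneg f : dprod A := fun i => bneg (f i).

Lemma dprod_ext f g : (forall i, f i = g i) -> f = g.
Proof. exact: functional_extensionality_dep. Qed.

Lemma dprod_le_refl : reflexive dprod_le.
Proof. by move=> f; apply/asboolP. Qed.

Lemma dprod_le_anti : antisymmetric dprod_le.
Proof.
move=> f g /andP[/asboolP fg /asboolP gf]; apply: dprod_ext => i.
by apply: le_anti; rewrite fg gf.
Qed.

Lemma dprod_le_trans : transitive dprod_le.
Proof.
move=> g f h /asboolP fg /asboolP gh; apply/asboolP => i.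
exact: le_trans (fg i) (gh i).
Qed.

HB.instance Definition _ := Order.Le_isPOrder.Build d (dprod A)
  dprod_le_refl dprod_le_anti dprod_le_trans.

Lemma dprod_leP f g : reflect (forall i, f i <= g i) (f <= g).
Proof. exact: asboolP. Qed.

Lemma dprod_meetP f g h : (f <= dprod_meet g h) = (f <= g) && (f <= h).
Proof.
apply/dprod_leP/andP => [fgh|[/dprod_leP fg /dprod_leP fh] i].
  by split; apply/dprod_leP => i; have := fgh i; rewrite lexI => /andP[].
by rewrite lexI fg fh.
Qed.

Lemma dprod_joinP f g h : (dprod_join f g <= h) = (f <= h) && (g <= h).
Proof.
apply/dprod_leP/andP => [fgh|[/dprod_leP fh /dprod_leP gh] i].
  by split; apply/dprod_leP => i; have := fgh i; rewrite leUx => /andP[].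
by rewrite leUx fh gh.
Qed.

HB.instance Definition _ := Order.POrder_MeetJoin_isLattice.Build d (dprod A)
  dprod_meetP dprod_joinP.

Lemma dprod_le0x f : dprod_bot <= f.
Proof. by apply/dprod_leP => i; apply: le0x. Qed.

Lemma dprod_lex1 f : f <= dprod_top.
Proof. by apply/dprod_leP => i; apply: lex1. Qed.

HB.instance Definition _ := Order.hasBottom.Build d (dprod A) dprod_le0x.
HB.instance Definition _ := Order.hasTop.Build d (dprod A) dprod_lex1.

Lemma dprod_kneg_anti f g : f <= g -> dprod_kneg g <= dprod_kneg f.
Proof. by move/dprod_leP => fg; apply/dprod_leP => i; apply/kneg_anti/fg. Qed.

Lemma dprod_knegK : involutive dprod_kneg.
Proof. by move=> f; apply: dprod_ext => i; apply: knegK. Qed.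

HB.instance Definition _ := TBLattice_isBILattice.Build d (dprod A)
  dprod_kneg_anti dprod_knegK.

Lemma dprod_kleene f g : f `&` kneg f <= g `|` kneg g.
Proof. by apply/dprod_leP => i; apply: kleene. Qed.

HB.instance Definition _ := BILattice_isPKA.Build d (dprod A) dprod_kleene.

Lemma dprod_bneg_anti f g : f <= g -> dprod_bneg g <= dprod_bneg f.
Proof. by move/dprod_leP => fg; apply/dprod_leP => i; apply/bneg_anti/fg. Qed.

Lemma dprod_meet_bneg f : f `&` dprod_bneg f = \bot.
Proof. by apply: dprod_ext => i; apply: meet_bneg. Qed.

Lemma dprod_le_bnegK f : f <= dprod_bneg (dprod_bneg f).
Proof. by apply/dprod_leP => i; apply: le_bnegK. Qed.

Lemma dprod_bneg_bneg f : dprod_bneg (dprod_bneg f) = kneg (dprod_bneg f).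
Proof. by apply: dprod_ext => i; apply: bneg_bneg. Qed.

HB.instance Definition _ := PKA_isBZLattice.Build d (dprod A)
  dprod_bneg_anti dprod_meet_bneg dprod_le_bnegK dprod_bneg_bneg.

End DirectProduct.

Record variety (d : Order.disp_t) (V : bz_class d) : Prop := Variety {
  variety_H : forall (A B : bzLatticeType d) (f : A -> B),
    bz_hom f -> surjective f -> V A -> V B;
  variety_S : forall (A B : bzLatticeType d) (f : A -> B),
    bz_hom f -> injective f -> V B -> V A;
  variety_P : forall (I : Type) (A : I -> bzLatticeType d),
    (forall i, V (A i)) -> V (dprod A)
}.

Definition V_BZL (d : Order.disp_t) (C : bz_class d) : bz_class d :=
  fun A => forall V : bz_class d, variety V -> (forall B, C B -> V B) -> V A.

Definition paraorthomodular (d : Order.disp_t) (A : biLatticeType d) : Prop :=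
  forall a b : A, a <= b -> kneg a `&` b = \bot -> a = b.

Definition PBZs (d : Order.disp_t) : bz_class d := fun A =>
  (forall x : A, bneg (x `&` kneg x) = bneg x `|` bneg (kneg x))
  /\ paraorthomodular A.

Definition AOL (d : Order.disp_t) : bz_class d := fun A =>
  PBZs A /\ forall x : A, x `|` kneg x = \top <-> x = \bot \/ x = \top.

Definition SDM (d : Order.disp_t) : bz_class d := fun A =>
  PBZs A /\ forall x y : A, bneg (x `&` y) = bneg x `|` bneg y.

Definition SAOL (d : Order.disp_t) : bz_class d := fun A =>
  SDM A /\ V_BZL (@AOL d) A.

(* The disjunct is redundant except for the subdirect embedding of a trivial  *)
(* algebra into the product of the empty family.                              *)
Definition subdirectly_irreducible (d : Order.disp_t) (A : bzLatticeType d) :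
    Prop :=
  (forall x y : A, x = y) \/
  forall (I : Type) (B : I -> bzLatticeType d) (f : A -> dprod B),
    bz_hom f -> injective f -> (forall i, surjective (fun x => f x i)) ->
    exists i, bijective (fun x => f x i).

Definition Si (d : Order.disp_t) (C : bz_class d) : bz_class d := fun A =>
  C A /\ subdirectly_irreducible A.

(* Being pseudo-Kleene is a property of BI-lattices, so the BI-lattice reduct *)
(* of a BZ-lattice can be taken in pkaType.                                   *)
Definition BI_reducts (d : Order.disp_t) (C : bz_class d) : pka_class d :=
  fun K => exists2 A : bzLatticeType d, C A & K = (A : pkaType d).

Definition all_PKA (d : Order.disp_t) : pka_class d := fun _ => True.

Inductive d2sum (T : Type) := D2bot | D2top | D2in of T.
Arguments D2bot {T}.
Arguments D2top {T}.

Section D2SumChoice.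
Variable T : choiceType.

Definition d2sum_encode (x : d2sum T) : option (option T) :=
  match x with D2bot => None | D2top => Some None | D2in a => Some (Some a) end.

Definition d2sum_decode (x : option (option T)) : d2sum T :=
  match x with None => D2bot | Some None => D2top | Some (Some a) => D2in a end.

Lemma d2sum_encodeK : cancel d2sum_encode d2sum_decode.
Proof. by case. Qed.

HB.instance Definition _ := Choice.copy (d2sum T) (can_type d2sum_encodeK).

End D2SumChoice.

Section D2Sum.
Variables (d : Order.disp_t) (K : pkaType d).
Implicit Types x y z : d2sum K.

Definition d2sum_le x y : bool :=
  match x, y with
  | D2bot, _ => true
  | _, D2top => true
  | D2in a, D2in b => a <= b
  | _, _ => false
  end.

Definition d2sum_meet x y : d2sum K :=
  match x, y with
  | D2bot, _ | _, D2bot => D2bot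
  | D2top, z | z, D2top => z
  | D2in a, D2in b => D2in (a `&` b)
  end.

Definition d2sum_join x y : d2sum K :=
  match x, y with
  | D2top, _ | _, D2top => D2top
  | D2bot, z | z, D2bot => z
  | D2in a, D2in b => D2in (a `|` b)
  end.

Definition d2sum_kneg x : d2sum K :=
  match x with
  | D2bot => D2top
  | D2top => D2bot
  | D2in a => D2in (kneg a)
  end.

Definition d2sum_bneg x : d2sum K := if x is D2bot then D2top else D2bot.

Lemma d2sum_le_refl : reflexive d2sum_le.
Proof. by case=> [||a] /=. Qed.

Lemma d2sum_le_anti : antisymmetric d2sum_le.
Proof. by move=> [||a] [||b] //= /le_anti ->. Qed.

Lemma d2sum_le_trans : transitive d2sum_le.
Proof. by move=> [||a] [||b] [||c] //=; apply: le_trans. Qed.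

HB.instance Definition _ := Order.Le_isPOrder.Build d (d2sum K)
  d2sum_le_refl d2sum_le_anti d2sum_le_trans.

Lemma d2sum_leE x y : (x <= y) = d2sum_le x y.
Proof. by []. Qed.

Lemma d2sum_meetP x y z : (x <= d2sum_meet y z) = (x <= y) && (x <= z).
Proof.
by rewrite !d2sum_leE; case: x y z => [||a] [||b] [||c] //=;
  rewrite ?andbT ?andbF ?lexI.
Qed.

Lemma d2sum_joinP x y z : (d2sum_join x y <= z) = (x <= z) && (y <= z).
Proof.
by rewrite !d2sum_leE; case: x y z => [||a] [||b] [||c] //=;
  rewrite ?andbT ?andbF ?leUx.
Qed.

HB.instance Definition _ := Order.POrder_MeetJoin_isLattice.Build d (d2sum K)
  d2sum_meetP d2sum_joinP.

Lemma d2sum_le0x x : D2bot <= x.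
Proof. by []. Qed.

Lemma d2sum_lex1 x : x <= D2top.
Proof. by case: x. Qed.

HB.instance Definition _ := Order.hasBottom.Build d (d2sum K) d2sum_le0x.
HB.instance Definition _ := Order.hasTop.Build d (d2sum K) d2sum_lex1.

Lemma d2sum_kneg_anti x y : x <= y -> d2sum_kneg y <= d2sum_kneg x.
Proof. by case: x y => [||a] [||b] //; apply: kneg_anti. Qed.

Lemma d2sum_knegK : involutive d2sum_kneg.
Proof. by case=> [||a] //=; rewrite knegK. Qed.

HB.instance Definition _ := TBLattice_isBILattice.Build d (d2sum K)
  d2sum_kneg_anti d2sum_knegK.

Lemma d2sum_kleene x y : x `&` kneg x <= y `|` kneg y.
Proof. by case: x y => [||a] [||b] //; apply: kleene. Qed.

HB.instance Definition _ := BILattice_isPKA.Build d (d2sum K) d2sum_kleene.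

Lemma d2sum_bneg_anti x y : x <= y -> d2sum_bneg y <= d2sum_bneg x.
Proof. by case: x y => [||a] [||b]. Qed.

Lemma d2sum_meet_bneg x : x `&` d2sum_bneg x = \bot.
Proof. by case: x. Qed.

Lemma d2sum_le_bnegK x : x <= d2sum_bneg (d2sum_bneg x).
Proof. by case: x. Qed.

Lemma d2sum_bneg_bneg x : d2sum_bneg (d2sum_bneg x) = kneg (d2sum_bneg x).
Proof. by case: x. Qed.

HB.instance Definition _ := PKA_isBZLattice.Build d (d2sum K)
  d2sum_bneg_anti d2sum_meet_bneg d2sum_le_bnegK d2sum_bneg_bneg.

End D2Sum.

Definition D2_sum_D2 (d : Order.disp_t) (C : pka_class d) : bz_class d :=
  fun A => exists2 K : pkaType d, C K & A = (d2sum K : bzLatticeType d).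

(* Main.v *)
From HB Require Import structures.
From mathcomp Require Import all_boot all_order.
From mathcomp Require Import generic_quotient boolp classical_sets.
Require Import Defs.

Set Implicit Arguments.
Unset Strict Implicit.
Unset Printing Implicit Defensive.
Import Order.Theory.
Local Open Scope quotient_scope.
Local Open Scope order_scope.

(** The four classes form a cycle of inclusions.

    The generated varieties increase from left to right: SAOL contains its
    subdirectly irreducible members, and their reducts are pseudo-Kleene
    algebras.

    Every [d2sum K] belongs to SAOL ([d2sum_SAOL]): its Brouwer complement is
    trivial, and its bottom is meet-irreducible, which for a trivial Brouwer
    complement is the strong De Morgan law.  Since SAOL is a variety
    ([variety_SAOL]), the largest of the three generated varieties is
    contained in SAOL.  Paraorthomodularity is only a quasi-identity, so
    closure of SAOL under quotients has to be earned: in V(AOL) the elements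
    [bneg y] split the algebra in two ([splits], a set of identities which are
    evident when [bneg y] is 0 or 1), and with the strong De Morgan law this
    forces paraorthomodularity ([splits_paraorthomodular]).

    Conversely, let A be in SAOL.  By Birkhoff's theorem
    ([subdirect_representation]), A embeds into a product of subdirectly
    irreducible members S of SAOL, so it suffices to treat S.  The splitting
    identities make [x `&` c = z `&` c], for [c := bneg y] and for
    [c := bneg (bneg y)], two congruences with trivial intersection; since S
    is irreducible one of them is equality, whence [bneg y] is 0 or 1
    ([irreducible_two_valued]).  Then 0 is meet-irreducible and 1 is
    join-irreducible in S, so that S becomes a subalgebra of [d2sum S] by
    sending 0 and 1 to the new bounds and fixing all other elements
    ([d2_embed_hom]).  A trivial S is instead a quotient of [d2sum S]. *)

(** * Involution and Brouwer complement *)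

Section Involution.
Variables (d : Order.disp_t) (A : biLatticeType d).
Implicit Types x y : A.

Lemma le_kneg x y : (kneg x <= kneg y) = (y <= x).
Proof.
by apply/idP/idP => /kneg_anti //; rewrite !knegK.
Qed.

Lemma kneg_join x y : kneg (x `|` y) = kneg x `&` kneg y.
Proof.
apply: le_anti; rewrite lexI !le_kneg leUl leUr /=.
by rewrite -[leLHS]knegK le_kneg leUx -[x]knegK -[y]knegK !le_kneg
  !knegK leIl leIr.
Qed.

Lemma kneg_meet x y : kneg (x `&` y) = kneg x `|` kneg y.
Proof. by rewrite -[RHS]knegK kneg_join !knegK. Qed.

Lemma joinE x y : x `|` y = kneg (kneg x `&` kneg y).
Proof. by rewrite kneg_meet !knegK. Qed.

Lemma kneg_bot : kneg \bot = \top :> A.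
Proof. by apply: le_anti; rewrite lex1 -[leLHS]knegK le_kneg le0x. Qed.

Lemma kneg_top : kneg \top = \bot :> A.
Proof. by rewrite -kneg_bot knegK. Qed.

End Involution.

Section Brouwer.
Variables (d : Order.disp_t) (A : bzLatticeType d).
Implicit Types x y : A.

Lemma bneg_top : bneg \top = \bot :> A.
Proof. by rewrite -[LHS]meet1x meet_bneg. Qed.

Lemma bneg_bot : bneg \bot = \top :> A.
Proof.
by apply: le_anti; rewrite lex1 -bneg_top le_bnegK.
Qed.

Lemma bneg_le_kneg x : bneg x <= kneg x.
Proof. by rewrite -[leLHS]knegK -bneg_bneg le_kneg le_bnegK. Qed.

Lemma bneg_eq_top x : bneg x = \top -> x = \bot.
Proof. by move=> x1; rewrite -[x]meetx1 -x1 meet_bneg. Qed.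

End Brouwer.

Lemma bz_hom_of_meet (d : Order.disp_t) (A B : bzLatticeType d) (f : A -> B) :
    {morph f : x y / x `&` y} -> {morph f : x / kneg x} ->
    {morph f : x / bneg x} -> f \bot = \bot ->
  bz_hom f.
Proof.
move=> fI fK fB f0; split=> //; last by rewrite -!kneg_bot fK f0.
by move=> x y; rewrite !joinE fK fI !fK.
Qed.

(** * Generated varieties *)

Section Generation.
Variable d : Order.disp_t.
Implicit Types C D V : bz_class d.

Lemma variety_V_BZL C : variety (V_BZL C).
Proof.
split=> [A B f fh fs VA | A B f fh fi VB | I A VA] V Vv CV.
- exact: (variety_H Vv) fh fs (VA V Vv CV).
- exact: (variety_S Vv) fh fi (VB V Vv CV).
- by apply: (variety_P Vv) => i; apply: VA.
Qed.

Lemma V_BZL_gen C A : C A -> V_BZL C A.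
Proof. by move=> CA V _; apply. Qed.

Lemma V_BZL_min C V : variety V -> (forall A, C A -> V A) ->
  forall A, V_BZL C A -> V A.
Proof. by move=> Vv CV A; apply. Qed.

Lemma V_BZL_mono C D : (forall A, C A -> D A) ->
  forall A, V_BZL C A -> V_BZL D A.
Proof.
move=> CD; apply: V_BZL_min; first exact: variety_V_BZL.
by move=> A /CD /V_BZL_gen.
Qed.

End Generation.

(** * SAOL is a variety *)

Section Identities.
Variable d : Order.disp_t.
Implicit Types A : bzLatticeType d.

Definition two_valued A := forall y : A, bneg y = \bot \/ bneg y = \top.

(** The elements [bneg y] are complemented by [bneg (bneg y)].  These
    identities say that meets with the two recover [x], and that meeting with
    either is compatible with both complements; compatibility with meets is
    automatic and with joins follows by duality. *)
Definition splits A := forall x y : A,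
  [/\ x = (x `&` bneg y) `|` (x `&` bneg (bneg y)),
      kneg x `&` bneg y = kneg (x `&` bneg y) `&` bneg y
    & bneg x `&` bneg y = bneg (x `&` bneg y) `&` bneg y].

Definition strong_deMorgan A := forall x y : A,
  bneg (x `&` y) = bneg x `|` bneg y.

Lemma two_valued_splits A : two_valued A -> splits A.
Proof.
move=> A2 x y; case: (A2 y) => ->.
  by rewrite bneg_bot !meetx0 meetx1 join0x.
by rewrite bneg_top meetx0 !meetx1 joinx0.
Qed.

Lemma variety_splits : variety splits.
Proof.
split=> [A B f fh fs As x y | A B f fh fi Bs x y | I A As x y].
- have [x0 <-] := fs x; have [y0 <-] := fs y.
  by have [e1 e2 e3] := As x0 y0; split;
    rewrite -!(bz_homB fh, bz_homK fh, bz_homI fh, bz_homU fh) -?e1 -?e2 -?e3.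
- by have [e1 e2 e3] := Bs (f x) (f y); split; apply: fi;
    rewrite !(bz_homB fh, bz_homK fh, bz_homI fh, bz_homU fh).
- by split; apply: dprod_ext => i; have [] := As i (x i) (y i).
Qed.

Lemma variety_strong_deMorgan : variety strong_deMorgan.
Proof.
split=> [A B f fh fs As x y | A B f fh fi Bs x y | I A As x y].
- have [x0 <-] := fs x; have [y0 <-] := fs y.
  by rewrite -!(bz_homB fh, bz_homI fh, bz_homU fh) As.
- by apply: fi; rewrite !(bz_homB fh, bz_homI fh, bz_homU fh) Bs.
- by apply: dprod_ext => i; apply: As.
Qed.

(** Let [a <= b] and [kneg a `&` b = \bot].  Split [b] along [bneg (kneg a)]:
    one part is below [kneg (kneg a) = a], and the other is [\bot], because
    the strong De Morgan law turns [kneg a `&` b = \bot] into the disjointness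
    of the Brouwer closures of [kneg a] and [b]. *)
Lemma splits_paraorthomodular A :
  splits A -> strong_deMorgan A -> paraorthomodular A.
Proof.
move=> As dM a b ab ab0; apply: le_anti; rewrite ab /=.
have [-> _ _] := As b (kneg a); rewrite leUx; apply/andP; split.
  by apply: le_trans (leIr _ _) _; rewrite -[leRHS]knegK bneg_le_kneg.
have disj : bneg (bneg b) `&` bneg (bneg (kneg a)) = \bot.
  by rewrite !bneg_bneg -kneg_join -dM meetC ab0 bneg_bot kneg_top.
by apply: le_trans (le0x a); rewrite -disj leI2 ?le_bnegK.
Qed.

(** Every [bneg y] is sharp: its involute is [bneg (bneg y)], with which it
    meets in [\bot]. *)
Lemma AOL_two_valued A : AOL A -> two_valued A.
Proof.
move=> [[star _] sharp] y.
suff: bneg y `|` kneg (bneg y) = \top by move/sharp.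
by rewrite joinC -[X in _ `|` X]knegK -kneg_meet -bneg_bneg meet_bneg kneg_bot.
Qed.

Lemma V_AOL_splits A : V_BZL (@AOL d) A -> splits A.
Proof.
apply: V_BZL_min; first exact: variety_splits.
by move=> B /AOL_two_valued /two_valued_splits.
Qed.

(** Relative to V(AOL), membership in SAOL is a single identity; this is what
    makes SAOL closed under homomorphic images. *)
Lemma SAOLP A : SAOL A <-> V_BZL (@AOL d) A /\ strong_deMorgan A.
Proof.
split=> [[[_ dM] VA] // | [VA dM]]; do 2!split=> //; split=> //.
exact: splits_paraorthomodular (V_AOL_splits VA) dM.
Qed.

Lemma variety_SAOL : variety (@SAOL d).
Proof.
have [VH VS VP] := variety_V_BZL (@AOL d).
have [DH DS DP] := variety_strong_deMorgan.
split=> [A B f fh fs /SAOLP[VA DA] | A B f fh fi /SAOLP[VB DB] | I A SA];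
  apply/SAOLP.
- by split; [apply: (VH A B f) | apply: (DH A B f)].
- by split; [apply: (VS A B f) | apply: (DS A B f)].
- by split; [apply: VP => i | apply: DP => i]; case/SAOLP: (SA i).
Qed.

Lemma d2sum_SAOL (K : pkaType d) : SAOL (d2sum K).
Proof.
have K2 : two_valued (d2sum K) by case=> [||a]; [right|left|left].
have dM : strong_deMorgan (d2sum K) by move=> [||a] [||b].
apply/SAOLP; split=> //; apply: V_BZL_gen; split.
  split=> [x | ]; first exact: dM.
  exact: splits_paraorthomodular (two_valued_splits K2) dM.
by case=> [||a]; split; [left|move=> _|right|move=> _|move=> //|case].
Qed.

End Identities.

(** * Congruences *)

Section Congruences.
Variables (d : Order.disp_t) (A : bzLatticeType d).
Implicit Types R S : A -> A -> Prop.

(** Compatibility with meets is asked in one argument only: the two-argument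
    form follows by transitivity, and joins are definable by the involution.
    For the union of a chain of congruences, transitivity is then the only
    condition that involves two members of the chain. *)
Record congruence R : Prop := Congruence {
  cong_refl : forall x, R x x;
  cong_sym : forall x y, R x y -> R y x;
  cong_trans : forall x y z, R x y -> R y z -> R x z;
  cong_meet : forall x y z, R x y -> R (x `&` z) (y `&` z);
  cong_kneg : forall x y, R x y -> R (kneg x) (kneg y);
  cong_bneg : forall x y, R x y -> R (bneg x) (bneg y)
}.

Lemma cong_meet2 R : congruence R -> forall x y z t,
  R x y -> R z t -> R (x `&` z) (y `&` t).
Proof.
move=> cR x y z t xy zt; apply: cong_trans (cong_meet cR z xy) _ => //.
by rewrite ![y `&` _]meetC; apply: cong_meet.
Qed.

Lemma kernel_congruence (B : bzLatticeType d) (f : A -> B) :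
  bz_hom f -> congruence (fun x y => f x = f y).
Proof.
move=> fh; split=> // [x y z ->|x y z|x y|x y] //.
- by rewrite !(bz_homI fh) => ->.
- by rewrite !(bz_homK fh) => ->.
- by rewrite !(bz_homB fh) => ->.
Qed.

(** Zorn's lemma on the congruences that do not identify [a] and [b]; the
    quotients by the maximal ones are subdirectly irreducible. *)
Lemma maximal_congruence (a b : A) : a <> b ->
  exists R, [/\ congruence R, ~ R a b
    & forall S, congruence S -> ~ S a b ->
        (forall x y, R x y -> S x y) -> forall x y, S x y -> R x y].
Proof.
move=> ab; pose T := {R : A -> A -> Prop | congruence R /\ ~ R a b}.
pose le (s t : T) : bool := `[< forall x y, sval s x y -> sval t x y >].
case: (@Zorn T le).
- by move=> s; apply/asboolP.
- by move=> r s t /asboolP rs /asboolP st; apply/asboolP => x y /rs /st.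
- move=> [s ps] [t pt] /asboolP /= st /asboolP /= ts; apply: eq_exist.
  by apply/funext => x; apply/funext => y; apply/propext; split=> [/st|/ts].
- move=> F Ftot.
  (* The diagonal makes the union a congruence for the empty chain too. *)
  pose U x y := x = y \/ exists2 s, F s & sval s x y.
  have cU : congruence U.
    split=> [x|x y [->|[s Fs xy]]|x y z [->//|[s Fs xy]] [<-|[t Ft yz]]
            |x y z [->|[s Fs xy]]|x y [->|[s Fs xy]]|x y [->|[s Fs xy]]];
      try (by left); right.
    + by exists s => //; apply: cong_sym xy; case: (svalP s).
    + by exists s.
    + have [/asboolP st|/asboolP ts] := Ftot s t Fs Ft.
        exists t => //; apply: cong_trans yz; [by case: (svalP t)|exact: st].
      exists s => //; apply: cong_trans xy _; [by case: (svalP s)|exact: ts].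
    + by exists s => //; apply: cong_meet xy; case: (svalP s).
    + by exists s => //; apply: cong_kneg xy; case: (svalP s).
    + by exists s => //; apply: cong_bneg xy; case: (svalP s).
  have Uab : ~ U a b by case=> // -[s _]; case: (svalP s).
  exists (exist _ U (conj cU Uab)) => s Fs; apply/asboolP => x y sxy /=.
  by right; exists s.
move=> [R [cR Rab]] Rmax; exists R; split=> // S cS Sab RS x y Sxy.
pose s : T := exist _ S (conj cS Sab).
have sR : s = exist _ R (conj cR Rab) by apply: Rmax; apply/asboolP.
by move: Sxy; rewrite -[S]/(sval s) sR.
Qed.

End Congruences.

(** * Quotient algebras *)

Section Quotient.
Variables (d : Order.disp_t) (A : bzLatticeType d) (R : A -> A -> Prop).
Variable cR : congruence R.

Definition cong_rel (x y : A) : bool := `[< R x y >].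

Lemma cong_rel_refl : reflexive cong_rel.
Proof. by move=> x; apply/asboolP/(cong_refl cR). Qed.

Lemma cong_rel_sym : symmetric cong_rel.
Proof. by move=> x y; apply/asboolP/asboolP; apply: (cong_sym cR). Qed.

Lemma cong_rel_trans : transitive cong_rel.
Proof.
by move=> y x z /asboolP xy /asboolP yz; apply/asboolP/(cong_trans cR xy yz).
Qed.

Definition cong_equiv :=
  EquivRel cong_rel cong_rel_refl cong_rel_sym cong_rel_trans.

Definition quot := {eq_quot cong_equiv}.
HB.instance Definition _ := Choice.on quot.

Definition to_quot (x : A) : quot := \pi_{eq_quot cong_equiv} x.

Lemma to_quotP x y : to_quot x = to_quot y <-> R x y.
Proof.
by split=> [/eqmodP /asboolP|Rxy] //; apply/eqmodP/asboolP.
Qed.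

Definition of_quot (p : quot) : A := repr (p : {eq_quot cong_equiv}).

Lemma of_quotK : cancel of_quot to_quot.
Proof. exact: reprK. Qed.

Lemma to_quotK x : R (of_quot (to_quot x)) x.
Proof. by apply/to_quotP; rewrite of_quotK. Qed.

Lemma to_quot_surj : surjective to_quot.
Proof. by move=> p; exists (of_quot p); apply: of_quotK. Qed.

Implicit Types p q r : quot.

Definition quot_meet p q : quot := to_quot (of_quot p `&` of_quot q).
Definition quot_kneg p : quot := to_quot (kneg (of_quot p)).
Definition quot_bneg p : quot := to_quot (bneg (of_quot p)).
(** Defining the join by duality reduces the laws of joins to those of meets. *)
Definition quot_join p q : quot :=
  quot_kneg (quot_meet (quot_kneg p) (quot_kneg q)).
Definition quot_le p q : bool := quot_meet p q == p.

Lemma to_quotI x y : to_quot (x `&` y) = quot_meet (to_quot x) (to_quot y).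
Proof.
by apply/to_quotP/(cong_sym cR)/(cong_meet2 cR); apply: to_quotK.
Qed.

Lemma to_quot_kneg x : to_quot (kneg x) = quot_kneg (to_quot x).
Proof. by apply/to_quotP/(cong_sym cR)/(cong_kneg cR)/to_quotK. Qed.

Lemma to_quot_bneg x : to_quot (bneg x) = quot_bneg (to_quot x).
Proof. by apply/to_quotP/(cong_sym cR)/(cong_bneg cR)/to_quotK. Qed.

Let to_quotE := (to_quotI, to_quot_kneg, to_quot_bneg).

Lemma quot_ind (P : quot -> Prop) : (forall x, P (to_quot x)) -> forall p, P p.
Proof. by move=> Px p; rewrite -[p]of_quotK. Qed.

Lemma quot_le_refl : reflexive quot_le.
Proof. by elim/quot_ind=> x; rewrite /quot_le -to_quotE meetxx. Qed.

Lemma quot_meetC : commutative quot_meet.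
Proof.
by elim/quot_ind=> x; elim/quot_ind=> y; rewrite -!to_quotE meetC.
Qed.

Lemma quot_meetA : associative quot_meet.
Proof.
elim/quot_ind=> x; elim/quot_ind=> y; elim/quot_ind=> z.
by rewrite -!to_quotE meetA.
Qed.

Lemma quot_le_anti : antisymmetric quot_le.
Proof. by move=> p q /andP[/eqP pq /eqP qp]; rewrite -[LHS]pq quot_meetC. Qed.

Lemma quot_le_trans : transitive quot_le.
Proof.
by move=> q p r /eqP pq /eqP qr; rewrite /quot_le -pq -quot_meetA qr.
Qed.

HB.instance Definition _ := Order.Le_isPOrder.Build d quot
  quot_le_refl quot_le_anti quot_le_trans.

Lemma quot_leE p q : (p <= q) = (quot_meet p q == p).
Proof. by []. Qed.

Lemma quot_meetP p q r : (p <= quot_meet q r) = (p <= q) && (p <= r).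
Proof.
rewrite !quot_leE; apply/eqP/andP => [<-|[/eqP pq /eqP pr]].
  split; apply/eqP; move: p q r;
    elim/quot_ind=> x; elim/quot_ind=> y; elim/quot_ind=> z;
    rewrite -!to_quotE -!meetA.
    by rewrite [z `&` y]meetC [y `&` (y `&` _)]meetA meetxx.
  by rewrite meetxx.
by rewrite quot_meetA pq.
Qed.

Lemma quot_knegK : involutive quot_kneg.
Proof. by elim/quot_ind=> x; rewrite -!to_quotE knegK. Qed.

Lemma quot_kneg_anti p q : p <= q -> quot_kneg q <= quot_kneg p.
Proof.
rewrite !quot_leE => /eqP <-; apply/eqP; move: p q.
elim/quot_ind=> x; elim/quot_ind=> y; rewrite -!to_quotE; congr to_quot.
by apply/meet_idPl; rewrite le_kneg leIr.
Qed.

Lemma quot_joinP p q r : (quot_join p q <= r) = (p <= r) && (q <= r).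
Proof.
have le_quot_kneg s t : (quot_kneg s <= quot_kneg t) = (t <= s).
  by apply/idP/idP => /quot_kneg_anti; rewrite ?quot_knegK.
by rewrite -[r in LHS]quot_knegK le_quot_kneg quot_meetP !le_quot_kneg.
Qed.

HB.instance Definition _ := Order.POrder_MeetJoin_isLattice.Build d quot
  quot_meetP quot_joinP.

Lemma quot_le0x p : to_quot \bot <= p.
Proof.
by rewrite quot_leE; elim/quot_ind: p => x; rewrite -to_quotE meet0x.
Qed.

Lemma quot_lex1 p : p <= to_quot \top.
Proof.
by rewrite quot_leE; elim/quot_ind: p => x; rewrite -to_quotE meetx1.
Qed.

HB.instance Definition _ := Order.hasBottom.Build d quot quot_le0x.
HB.instance Definition _ := Order.hasTop.Build d quot quot_lex1.
HB.instance Definition _ := TBLattice_isBILattice.Build d quot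
  quot_kneg_anti quot_knegK.

Lemma quot_kleene p q : p `&` kneg p <= q `|` kneg q.
Proof.
elim/quot_ind: p => x; elim/quot_ind: q => y.
have -> : to_quot x `&` kneg (to_quot x) = to_quot (x `&` kneg x).
  by rewrite !to_quotE.
have -> : to_quot y `|` kneg (to_quot y) = to_quot (y `|` kneg y).
  by rewrite joinE [in RHS]joinE !to_quotE.
by rewrite quot_leE -to_quotE; apply/eqP; congr to_quot; apply/meet_idPl/kleene.
Qed.

HB.instance Definition _ := BILattice_isPKA.Build d quot quot_kleene.

Lemma quot_bneg_anti p q : p <= q -> quot_bneg q <= quot_bneg p.
Proof.
rewrite !quot_leE => /eqP <-; apply/eqP; move: p q.
elim/quot_ind=> x; elim/quot_ind=> y; rewrite -!to_quotE; congr to_quot.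
by apply/meet_idPl; rewrite bneg_anti ?leIr.
Qed.

Lemma quot_meet_bneg p : p `&` quot_bneg p = \bot.
Proof.
elim/quot_ind: p => x; rewrite -to_quotE; apply: etrans (esym (to_quotI _ _)) _.
by rewrite meet_bneg.
Qed.

Lemma quot_le_bnegK p : p <= quot_bneg (quot_bneg p).
Proof.
rewrite quot_leE; elim/quot_ind: p => x; rewrite -!to_quotE.
by apply/eqP; congr to_quot; apply/meet_idPl/le_bnegK.
Qed.

Lemma quot_bneg_bneg p : quot_bneg (quot_bneg p) = kneg (quot_bneg p).
Proof.
by elim/quot_ind: p => x; rewrite /kneg /= -!to_quotE bneg_bneg.
Qed.

HB.instance Definition _ := PKA_isBZLattice.Build d quot
  quot_bneg_anti quot_meet_bneg quot_le_bnegK quot_bneg_bneg.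

Lemma to_quot_hom : bz_hom to_quot.
Proof.
apply: bz_hom_of_meet => //; [exact: to_quotI | exact: to_quot_kneg |].
exact: to_quot_bneg.
Qed.

End Quotient.

(** * Subdirect representation *)

Section SubdirectProducts.
Variable d : Order.disp_t.
Implicit Types A : bzLatticeType d.

Lemma tuple_hom A I (B : I -> bzLatticeType d) (f : forall i, A -> B i) :
  (forall i, bz_hom (f i)) -> bz_hom (fun x => (fun i => f i x) : dprod B).
Proof.
move=> fh; apply: bz_hom_of_meet => [x y|x|x|]; apply: dprod_ext => i.
- exact: bz_homI (fh i) x y.
- exact: bz_homK (fh i) x.
- exact: bz_homB (fh i) x.
- exact: bz_hom0 (fh i).
Qed.

Lemma coordinate_hom A I (B : I -> bzLatticeType d) (f : A -> dprod B) i :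
  bz_hom f -> bz_hom (fun x => f x i).
Proof.
move=> fh; apply: bz_hom_of_meet => [x y|x|x|].
- by rewrite (bz_homI fh).
- by rewrite (bz_homK fh).
- by rewrite (bz_homB fh).
- by rewrite (bz_hom0 fh).
Qed.

Lemma inj_surj_bijective (T U : Type) (f : T -> U) :
  injective f -> surjective f -> bijective f.
Proof.
move=> fi /choice[g gK]; exists g => // x; exact/fi.
Qed.

(** Some component of a subdirect embedding of the quotient separates the
    classes of [a] and [b]; its kernel, pulled back to [A], contains [R], so
    equals [R] by maximality, and that component is injective. *)
Lemma irreducible_of_maximal A (a b : A) (R : A -> A -> Prop)
    (cR : congruence R) : ~ R a b ->
    (forall S, congruence S -> ~ S a b ->
        (forall x y, R x y -> S x y) -> forall x y, S x y -> R x y) ->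
  subdirectly_irreducible (quot cR).
Proof.
move=> Rab Rmax; right=> I B f fh fi fs.
have [i Sab] : exists i, f (to_quot cR a) i <> f (to_quot cR b) i.
  apply/existsNP => fab; apply/Rab/(to_quotP cR)/fi/dprod_ext => i.
  exact: fab.
exists i; apply: inj_surj_bijective (fs i); elim/quot_ind=> x.
elim/quot_ind=> y fxy; apply/to_quotP; move: x y fxy.
apply: (Rmax (fun x y => f (to_quot cR x) i = f (to_quot cR y) i)) => //.
  have [cr cs ct ci ck cb] := kernel_congruence (coordinate_hom i fh).
  have [hI _ hK hB _ _] := to_quot_hom cR.
  split=> [x|x y|x y z|x y z|x y|x y]; rewrite ?hI ?hK ?hB.
  - by [].
  - exact: cs.
  - exact: ct.
  - exact: ci.
  - exact: ck.
  - exact: cb.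
by move=> x y /(to_quotP cR) ->.
Qed.

(** Birkhoff's theorem: the factors are the quotients by congruences maximal
    among those separating a given pair, one for each pair of distinct
    elements, so that the product of the projections is injective. *)
Lemma subdirect_representation (V : bz_class d) A : variety V -> V A ->
  exists (I : Type) (B : I -> bzLatticeType d) (f : A -> dprod B),
    [/\ bz_hom f, injective f & forall i, Si V (B i)].
Proof.
move=> Vv VA; pose I := {p : A * A | p.1 <> p.2}.
have /choice[R RP] (i : I) := maximal_congruence (svalP i).
have cR i : congruence (R i) by case: (RP i).
exists I, (fun i => quot (cR i) : bzLatticeType d).
exists (fun x => fun i => to_quot (cR i) x); split.
- by apply: tuple_hom => i; apply: to_quot_hom.
- move=> x y fxy; apply: contrapT => xy; pose i : I := exist _ (x, y) xy.
  have [_ + _] := RP i; apply; apply/(to_quotP (cR i)).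
  exact: (congr1 (fun g => g i) fxy).
- move=> i; split.
    exact: (variety_H Vv) (to_quot_hom (cR i)) (@to_quot_surj _ _ _ _) VA.
  by have [_ Ri Rmax] := RP i; apply: irreducible_of_maximal Ri Rmax.
Qed.

(** Equality is meet-irreducible among the congruences of [A], since [A] is a
    subdirect product of its quotients by [R] and [S]. *)
Lemma irreducible_congruences A (R S : A -> A -> Prop) :
    subdirectly_irreducible A -> congruence R -> congruence S ->
    (forall x y, R x y -> S x y -> x = y) ->
  (forall x y, R x y -> x = y) \/ (forall x y, S x y -> x = y).
Proof.
move=> [A1|Airr] cR cS RS; first by left=> x y _; apply: A1.
pose B (b : bool) : bzLatticeType d := 
  if b then (quot cR : bzLatticeType d) else (quot cS : bzLatticeType d).
pose f b : A -> B b := 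
  if b return A -> B b then to_quot cR else to_quot cS.
case: (Airr bool B (fun x => (fun b => f b x))) => [|x y fxy|i|].
- by apply: tuple_hom; case; apply: to_quot_hom.
- apply: RS.
    by apply/(to_quotP cR)/(congr1 (fun g => g true) fxy).
  by apply/(to_quotP cS)/(congr1 (fun g => g false) fxy).
- by case: i; apply: to_quot_surj.
- by case=> /bij_inj fi; [left|right] => x y Rxy; apply/fi/to_quotP.
Qed.

(** * Subdirectly irreducible members of SAOL *)

Lemma splits_congruence A (y : A) : splits A ->
  congruence (fun x z : A => x `&` bneg y = z `&` bneg y).
Proof.
move=> As; split=> // [x z t -> //|x z t xz|x z xz|x z xz].
- by rewrite meetAC xz meetAC.
- by have [_ -> _] := As x y; have [_ -> _] := As z y; rewrite xz.
- by have [_ _ ->] := As x y; have [_ _ ->] := As z y; rewrite xz.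
Qed.

(** The congruences given by [bneg y] and by its complement meet in equality,
    by the splitting identity; the one that is trivial identifies its own
    element with [\top]. *)
Lemma irreducible_two_valued A :
  splits A -> subdirectly_irreducible A -> two_valued A.
Proof.
move=> As Airr y.
have [x z Rxz Sxz|R0|S0] := irreducible_congruences Airr
    (splits_congruence y As) (splits_congruence (bneg y) As).
- by have [-> _ _] := As x y; have [-> _ _] := As z y; rewrite Rxz Sxz.
- by right; apply: R0; rewrite meetxx meet1x.
- left; have : bneg (bneg y) = \top by apply: S0; rewrite meetxx meet1x.
  by rewrite bneg_bneg => /(congr1 kneg); rewrite knegK kneg_top.
Qed.

Definition d2_embed (A : bzLatticeType d) (x : A) : d2sum A :=
  if x == \bot then D2bot else if x == \top then D2top else D2in x.

Lemma d2_embed_inj A : injective (@d2_embed A).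
Proof.
move=> x y; rewrite /d2_embed.
by do 4?[case: eqP => [->|_] //] => -[].
Qed.

(** The point is that [x `&` y = \bot] only if [x] or [y] is [\bot]: otherwise
    a meet of two elements of the middle part, computed in [A], would have to
    be the new bottom.  Apply [bneg] to see this, the strong De Morgan law
    giving a join of two-valued elements. *)
Lemma d2_embed_hom A : \bot != \top :> A -> two_valued A ->
  strong_deMorgan A -> bz_hom (@d2_embed A).
Proof.
move=> A01 A2 dM.
have meet0 (x y : A) : (x `&` y == \bot) = (x == \bot) || (y == \bot).
  apply/eqP/orP => [/(congr1 bneg)|[]/eqP->]; last 2 first.
    by rewrite meet0x.
    by rewrite meetx0.
  rewrite dM bneg_bot; case: (A2 x) => [->|/bneg_eq_top ->]; last by left.
  by rewrite join0x => /bneg_eq_top ->; right.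
have meet1 (x y : A) : (x `&` y == \top) = (x == \top) && (y == \top).
  apply/eqP/andP => [xy|[/eqP-> /eqP->]]; last by rewrite meetxx.
  by split; apply/eqP/le_anti; rewrite lex1 -xy ?leIl ?leIr.
apply: bz_hom_of_meet => [x y|x|x|]; rewrite /d2_embed.
- rewrite meet0 meet1.
  have [//|_] := eqVneq x \bot; have [_|_] := eqVneq y \bot => /=.
    by case: ifP.
  have [->|x1] := eqVneq x \top => /=.
    by rewrite meet1x; case: ifP.
  by have [->|] := eqVneq y \top; rewrite ?meetx1.
- rewrite !(can2_eq (@knegK _ _) (@knegK _ _)) kneg_bot kneg_top.
  case: (x =P \bot) => [->|_]; first by rewrite (negPf A01).
  by case: ifP.
- case: (x =P \bot) => [->|x0].
    by rewrite bneg_bot eq_sym (negPf A01) eqxx.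
  case: (A2 x) => [->|/bneg_eq_top //]; rewrite eqxx.
  by case: ifP.
- by rewrite eqxx.
Qed.

Lemma irreducible_in_V_d2sum A :
  Si (@SAOL d) A -> V_BZL (D2_sum_D2 (BI_reducts (Si (@SAOL d)))) A.
Proof.
move=> SiA; have [SA Airr] := SiA.
have gen : V_BZL (D2_sum_D2 (BI_reducts (Si (@SAOL d)))) (d2sum A).
  by apply: V_BZL_gen; exists (A : pkaType d) => //; exists A.
have [A01|A01] := eqVneq (\bot : A) \top.
  have A1 (x y : A) : x = y.
    have all0 (z : A) : z = \bot by rewrite -[z]meetx1 -A01 meetx0.
    by rewrite (all0 x) (all0 y).
  (* [d2_embed] does not respect both bounds when they coincide. *)
  apply: (variety_H (variety_V_BZL _)) (_ : bz_hom (fun _ => \bot)) _ gen.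
    by apply: bz_hom_of_meet.
  by move=> y; exists \bot.
apply: (variety_S (variety_V_BZL _)) (@d2_embed_inj A) gen.
have [[_ dM] VA] := SA; apply: d2_embed_hom => //.
exact: irreducible_two_valued (V_AOL_splits VA) Airr.
Qed.

End SubdirectProducts.

Theorem theorem4p6 (d : Order.disp_t) :
  (@SAOL d =c V_BZL (D2_sum_D2 (BI_reducts (Si (@SAOL d)))))
  /\ (V_BZL (D2_sum_D2 (BI_reducts (Si (@SAOL d))))
        =c V_BZL (D2_sum_D2 (BI_reducts (@SAOL d))))
  /\ (V_BZL (D2_sum_D2 (BI_reducts (@SAOL d)))
        =c V_BZL (D2_sum_D2 (@all_PKA d))).
Proof.
have down (A : bzLatticeType d) :
    SAOL A -> V_BZL (D2_sum_D2 (BI_reducts (Si (@SAOL d)))) A.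
  move=> SA.
  have [I [B [f [fh fi SiB]]]] := subdirect_representation (variety_SAOL d) SA.
  apply: (variety_S (variety_V_BZL _)) fh fi _.
  apply: (variety_P (variety_V_BZL _)) => i.
  exact: irreducible_in_V_d2sum (SiB i).
have up12 (A : bzLatticeType d) :
    V_BZL (D2_sum_D2 (BI_reducts (Si (@SAOL d)))) A ->
    V_BZL (D2_sum_D2 (BI_reducts (@SAOL d))) A.
  by apply: V_BZL_mono => _ [_ [B [SB _] ->] ->]; exists (B : pkaType d) => //;
    exists B.
have up23 (A : bzLatticeType d) :
    V_BZL (D2_sum_D2 (BI_reducts (@SAOL d))) A ->
    V_BZL (D2_sum_D2 (@all_PKA d)) A.
  by apply: V_BZL_mono => _ [K _ ->]; exists K.
have up3 (A : bzLatticeType d) : V_BZL (D2_sum_D2 (@all_PKA d)) A -> SAOL A.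
  by apply: V_BZL_min (variety_SAOL d) _ A => _ [K _ ->]; apply: d2sum_SAOL.
split; [|split] => A; split.
- exact: down.
- by move=> /up12 /up23 /up3.
- exact: up12.
- by move=> /up23 /up3 /down.
- exact: up23.
- by move=> /up3 /down /up12.
Qed.
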